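(* The number of polynomials in $\mathcal{H}(2,3)$ with four distinct terms is twelve.
   Context: $\mathcal{H}(2,d)$ denotes the set of polynomials $f\in\mathbb{R}[x,y]$ of total degree $d$ arising from reduced models, i.e. polynomials of the form $f=\sum_{i=0}^n c_i x^{\mu_i}y^{\nu_i}$ (for some $n$) with real coefficients $c_i>0$, pairwise distinct exponent pairs in $\mathbb{N}^2$ all different from $(0,0)$ (so $f$ has zero constant term), and $f(x,y)=1$ whenever $x+y=1$. The number of terms of $f$ is its number $n+1$ of monomials with non-zero coefficient. Polynomials differing by swapping the variables $x$ and $y$ are counted separately when they are different. *)

(* Defs.v *)
From mathcomp Require Import all_boot all_order all_algebra.
From mathcomp Require Import classical_sets cardinality reals.
From mathcomp Require Import mpoly.

Set Implicit Arguments.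
Unset Strict Implicit.
Unset Printing Implicit Defensive.

Import GRing.Theory Num.Theory.
Local Open Scope classical_set_scope.
Local Open Scope ring_scope.

Section ReducedModels.
Variable R : realType.

Definition reduced_model_poly (n : nat) (c : 'I_n.+1 -> R)
    (mu nu : 'I_n.+1 -> nat) : {mpoly R[2]} :=
  \sum_(i < n.+1) c i *: ('X_(0 : 'I_2) ^+ mu i * 'X_(1 : 'I_2) ^+ nu i).

Definition is_reduced_model (n : nat) (c : 'I_n.+1 -> R)
    (mu nu : 'I_n.+1 -> nat) : Prop :=
  [/\ forall i, 0 < c i,
      injective (fun i => (mu i, nu i)),
      forall i, (mu i, nu i) <> (0%N, 0%N)
    & forall x y : R, x + y = 1 ->
        (reduced_model_poly c mu nu).@[tnth [tuple x; y]] = 1].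

(* msize is one more than the total degree of a nonzero polynomial. *)
Definition H2 (d : nat) : set {mpoly R[2]} :=
  [set f | msize f = d.+1 /\
    exists (n : nat) (c : 'I_n.+1 -> R) (mu nu : 'I_n.+1 -> nat),
      is_reduced_model c mu nu /\ f = reduced_model_poly c mu nu].

Definition num_terms (f : {mpoly R[2]}) : nat := size (msupp f).

End ReducedModels.

Arguments H2 R d : clear implicits.

(* Main.v *)
(** On the line [x + y = 1] multiply every monomial [x^a y^b] of a cubic by
    [(x + y)^(3 - a - b)]: the condition [f = 1] becomes the equality of two
    binary cubic forms, [f] homogenized on one side and [(x + y)^3] on the
    other, that is, four linear equations in the nine nonnegative coefficients
    of [f].  Prescribing which four coefficients are non-zero leaves either no
    positive solution of degree 3 or exactly one; the twelve solutions have
    integer coefficients. *)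

Require Import Defs.
From mathcomp Require Import all_boot all_order all_algebra.
From mathcomp Require Import classical_sets cardinality reals.
From mathcomp Require Import mpoly.
From mathcomp Require Import ring lra.

Local Open Scope classical_set_scope.
Local Open Scope card_scope.

Set Implicit Arguments.
Unset Strict Implicit.
Unset Printing Implicit Defensive.

Import Order.TTheory GRing.Theory Num.Theory.
Local Open Scope ring_scope.

(** * Bivariate monomials as exponent pairs *)

Definition mnm2 (e : nat * nat) : 'X_{1..2} := [multinom [tuple e.1; e.2]].

Lemma mnm2_inj : injective mnm2.
Proof. by move=> [a b] [c d] [/= -> ->]. Qed.

Lemma mnm2_surj (m : 'X_{1..2}) :
  m = mnm2 (m (0 : 'I_2), m (1 : 'I_2)).
Proof.
apply/mnmP => i; rewrite !multinomE /= !(tnth_nth 0%N) /=.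
by case: i => -[i2|[i2|//]]; congr (m _); apply: val_inj.
Qed.

Lemma mdeg_mnm2 e : mdeg (mnm2 e) = (e.1 + e.2)%N.
Proof.
by rewrite mdegE !big_ord_recl big_ord0 !multinomE !(tnth_nth 0%N) /= addn0.
Qed.

Lemma mnm2_00 : mnm2 (0, 0)%N = 0%MM.
Proof. by apply/eqP; rewrite -mdeg_eq0 mdeg_mnm2. Qed.

(** Sorted by degree, so that dropping the first five entries leaves exactly the monomials of degree
    3. The constant monomial is left out because reduced models have zero constant term. *)
Definition cubic_mnms : seq 'X_{1..2} :=
  [seq mnm2 e | e <- [:: (1, 0); (0, 1); (2, 0); (1, 1); (0, 2);
                         (3, 0); (2, 1); (1, 2); (0, 3)]%N].

Lemma uniq_cubic_mnms : uniq cubic_mnms.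
Proof. by rewrite map_inj_uniq //; apply: mnm2_inj. Qed.

Section SharpCubics.
Variable R : realType.
Implicit Type f : {mpoly R[2]}.

Lemma mpolyX_mnm2 e :
  'X_[mnm2 e] = 'X_(0 : 'I_2) ^+ e.1 * 'X_(1 : 'I_2) ^+ e.2 :> {mpoly R[2]}.
Proof.
rewrite mpolyXE_id !big_ord_recl big_ord0 mulr1 !multinomE !(tnth_nth 0%N) /=.
by congr (_ * 'X_ _ ^+ _); apply/val_inj.
Qed.

Lemma reduced_model_polyE n (c : 'I_n.+1 -> R) mu nu :
  reduced_model_poly c mu nu = \sum_i c i *: 'X_[mnm2 (mu i, nu i)].
Proof. by apply: eq_bigr => i _; rewrite mpolyX_mnm2. Qed.

(** Removes the choice of a presentation. Nonnegative coefficients suffice for the converse: listing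
    the support of [f] gives a presentation in which every coefficient is non-zero, hence
    positive. *)
Lemma H2P d f : H2 R d f <->
  [/\ msize f = d.+1, forall m, 0 <= f@_m, f@_0%MM = 0
    & forall x y : R, x + y = 1 -> f.@[tnth [tuple x; y]] = 1].
Proof.
split=> [[szf [n [c [mu [nu [[c_gt0 inj nz f1] fE]]]]]] | [szf f_ge0 f0 f1]].
  split=> // [m||x y xy1]; last by rewrite fE; apply: f1.
    rewrite fE reduced_model_polyE raddf_sum sumr_ge0 // => i _ /=.
    by rewrite mcoeffZ mcoeffX mulr_ge0 ?ler0n // ltW.
  rewrite fE reduced_model_polyE raddf_sum big1 // => i _ /=.
  rewrite mcoeffZ mcoeffX (_ : _ == _ = false) ?mulr0 //.
  apply/negbTE/eqP => /(congr1 (@mdeg 2)); rewrite mdeg_mnm2 mdeg0 /=.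
  move=> /eqP; rewrite addn_eq0 => /andP[/eqP mu0 /eqP nu0].
  by apply: (nz i); rewrite mu0 nu0.
split=> //.
(* A model is indexed by ['I_n.+1], so it has at least one term; the zero polynomial is excluded by
   its value at the point (1, 0). *)
have : msupp f != [::].
  rewrite msupp_eq0; apply/eqP => fz.
  by have /esym/eqP := f1 1 0 (addr0 1); rewrite fz meval0 oner_eq0.
rewrite -size_eq0 -lt0n => /prednK; set n := _.-1 => szE.
pose m (i : 'I_n.+1) := nth 0%MM (msupp f) i.
pose mu i := m i (0 : 'I_2); pose nu i := m i (1 : 'I_2).
have mE i : m i = mnm2 (mu i, nu i) by exact: mnm2_surj.
have m_supp i : m i \in msupp f by rewrite mem_nth // -szE.
have fE : f = reduced_model_poly (fun i => f@_(m i)) mu nu.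
  rewrite reduced_model_polyE [LHS]mpolyE (big_nth 0%MM) big_mkord -szE.
  by apply: eq_bigr => i _; rewrite -mE.
exists n, (fun i => f@_(m i)), mu, nu; split=> //.
split=> [i|i j eqm|i [mu0 nu0]|].
- by rewrite lt_neqAle f_ge0 eq_sym -mcoeff_msupp m_supp.
- apply/val_inj/eqP.
  rewrite -(nth_uniq 0%MM _ _ (msupp_uniq f)) -?szE ?ltn_ord //; apply/eqP.
  by rewrite -![nth _ _ _]/(m _) !mE eqm.
- by have := m_supp i; rewrite mE mu0 nu0 mnm2_00 mcoeff_msupp f0 eqxx.
- by rewrite -fE.
Qed.

(** * Cubics without constant term as lists of nine coefficients *)

Definition cubic (a : seq R) : {mpoly R[2]} :=
  \sum_(i < 9) a`_i *: 'X_[nth 0%MM cubic_mnms i].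

Lemma mcoeff_cubic a i : (i < 9)%N -> (cubic a)@_(nth 0%MM cubic_mnms i) = a`_i.
Proof.
move=> i9; rewrite raddf_sum /= (bigD1 (Ordinal i9)) //= big1 => [|j ji].
  by rewrite mcoeffZ mcoeffX eqxx mulr1 addr0.
rewrite mcoeffZ mcoeffX nth_uniq ?uniq_cubic_mnms //.
by rewrite (negbTE (ji : val j != i)) mulr0.
Qed.

Lemma mcoeff_cubic_out a m : m \notin cubic_mnms -> (cubic a)@_m = 0.
Proof.
move=> mN; rewrite raddf_sum big1 // => j _ /=.
rewrite mcoeffZ mcoeffX (_ : _ == _ = false) ?mulr0 //.
by apply: contraNF mN => /eqP <-; rewrite mem_nth.
Qed.

Lemma map_mcoeff_cubic a : size a = 9 ->
  [seq (cubic a)@_m | m <- cubic_mnms] = a.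
Proof.
move=> sza; apply: (@eq_from_nth _ 0) => [|i]; rewrite size_map // => i9.
by rewrite (nth_map 0%MM) // mcoeff_cubic.
Qed.

(** Coefficients vanish outside [cubic_mnms], so up to order the support is a sublist of it. *)
Lemma num_terms_cubic a : size a = 9 ->
  num_terms (cubic a) = count (fun c => c != 0) a.
Proof.
move=> sza; rewrite -[in RHS](map_mcoeff_cubic sza) count_map -size_filter.
apply/perm_size/uniq_perm; rewrite ?filter_uniq ?uniq_cubic_mnms // => m.
rewrite mem_filter /= mcoeff_msupp.
case: (boolP (m \in _)) => [|/mcoeff_cubic_out ->].
  by rewrite andbT.
by rewrite eqxx.
Qed.

Lemma meval_cubic a x y : (cubic a).@[tnth [tuple x; y]] =
  a`_0 * x + a`_1 * y + a`_2 * x ^+ 2 + a`_3 * (x * y) + a`_4 * y ^+ 2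
  + a`_5 * x ^+ 3 + a`_6 * (x ^+ 2 * y) + a`_7 * (x * y ^+ 2) + a`_8 * y ^+ 3.
Proof.
have evX e : 'X_[mnm2 e].@[tnth [tuple x; y]] = x ^+ e.1 * y ^+ e.2.
  by rewrite mevalX !big_ord_recl big_ord0 mulr1.
rewrite raddf_sum /= !big_ord_recl big_ord0 !mevalZ !evX /=.
by rewrite !expr0 !expr1 !mulr1 !mul1r addr0 !addrA.
Qed.

Lemma msize_cubic a : size a = 9 ->
  (msize (cubic a) == 4%N) = has (fun c => c != 0) (drop 5 a).
Proof.
move=> sza; have le4 : (msize (cubic a) <= 4)%N.
  rewrite msizeE; apply/bigmax_leqP_seq => m /[!mcoeff_msupp] + _.
  apply: contraR; rewrite -ltnNge => m4; rewrite mcoeff_cubic_out //.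
  by apply: contraTN m4; move: m; apply/allP; rewrite /= !mdeg_mnm2.
rewrite -[in RHS](map_mcoeff_cubic sza) -map_drop has_map.
apply/eqP/hasP => [sz4 | [m m5 /= am]].
  have : cubic a != 0 by rewrite -msize_poly_eq0 sz4.
  (* The leading monomial has degree 3 and lies in [cubic_mnms], hence among its last four
     entries. *)
  move=> nz; exists (mlead (cubic a)); last first.
    by rewrite /= -mcoeff_msupp mlead_supp.
  have: mdeg (mlead (cubic a)) = 3%N by apply: succn_inj; rewrite mlead_deg.
  have: mlead (cubic a) \in cubic_mnms.
    apply: contraLR (mlead_supp nz) => /mcoeff_cubic_out.
    by rewrite -mcoeff_eq0 => ->.
  move: (mlead _) => m; rewrite !inE.
  by do ![case: eqP => [->|_] /=; rewrite ?orbT ?mdeg_mnm2 //].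
apply/eqP; rewrite eqn_leq le4 /=.
have <- : mdeg m = 3%N.
  by apply/eqP; move: m m5 {am}; apply/allP; rewrite /= !mdeg_mnm2.
by apply: msize_mdeg_lt; rewrite mcoeff_msupp.
Qed.

Lemma cubic_mcoeff f : (msize f <= 4)%N -> f@_0%MM = 0 ->
  f = cubic [seq f@_m | m <- cubic_mnms].
Proof.
move=> szf f0; apply/mpolyP => m.
case: (boolP (m \in cubic_mnms)) => [/(nthP 0%MM) [i i9 <-] | mN].
  by rewrite mcoeff_cubic // (nth_map 0%MM).
rewrite mcoeff_cubic_out //; apply: contraNeq mN; rewrite -mcoeff_msupp => mf.
have : m != 0%MM by apply: contraTneq mf => ->; rewrite mcoeff_msupp f0 eqxx.
have := leq_trans (msize_mdeg_lt mf) szf; rewrite -mnm2_00 {mf}.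
rewrite [m]mnm2_surj mdeg_mnm2 (inj_eq mnm2_inj) /cubic_mnms (mem_map mnm2_inj).
(* The degree is below 4, so only finitely many exponent pairs remain to be inspected. *)
by move: (m _) (m _) => [|[|[|[|i]]]] [|[|[|[|j]]]] //.
Qed.

(** The four equations compare the coefficients of x^3, x^2 y, x y^2 and y^3 in the homogenized
    cubic and in (x + y)^3. *)
Lemma meval_cubic_eq1 a :
  (forall x y : R, x + y = 1 -> (cubic a).@[tnth [tuple x; y]] = 1) <->
  [/\ a`_0 + a`_2 + a`_5 = 1, 2 * a`_0 + a`_1 + a`_2 + a`_3 + a`_6 = 3,
      a`_0 + 2 * a`_1 + a`_3 + a`_4 + a`_7 = 3 & a`_1 + a`_4 + a`_8 = 1].
Proof.
split=> [a1 | [e1 e2 e3 e4] x y xy1].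
  (* On the line the cubic is a polynomial of degree at most 3 in x, so its values at four points
     determine it. *)
  have := a1 1 0; have := a1 0 1; have := a1 2 (-1); have := a1 (-1) 2.
  rewrite !meval_cubic => E1 E2 E3 E4.
  have {}E1 := E1 ltac:(ring); have {}E2 := E2 ltac:(ring).
  have {}E3 := E3 ltac:(ring); have {}E4 := E4 ltac:(ring).
  by split; lra.
rewrite meval_cubic.
(* The equations express the four top-degree coefficients through the five lower ones; after
   substitution an identity in x remains. *)
have -> : y = 1 - x by lra.
have -> : a`_5 = 1 - a`_0 - a`_2 by lra.
have -> : a`_6 = 3 - 2 * a`_0 - a`_1 - a`_2 - a`_3 by lra.
have -> : a`_7 = 3 - a`_0 - 2 * a`_1 - a`_3 - a`_4 by lra.
have -> : a`_8 = 1 - a`_1 - a`_4 by lra.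
by ring.
Qed.

End SharpCubics.

(* Coefficients of the monomials in the order of [cubic_mnms]. *)
Definition four_term_cubics : seq (seq nat) :=
  [:: [:: 1; 0; 0; 1; 0; 0; 0; 1; 1]
    ; [:: 1; 0; 0; 0; 1; 0; 1; 1; 0]
    ; [:: 1; 0; 0; 0; 0; 0; 1; 2; 1]
    ; [:: 0; 1; 1; 0; 0; 0; 1; 1; 0]
    ; [:: 0; 1; 0; 1; 0; 1; 1; 0; 0]
    ; [:: 0; 1; 0; 0; 0; 1; 2; 1; 0]
    ; [:: 0; 0; 1; 2; 0; 0; 0; 1; 1]
    ; [:: 0; 0; 1; 0; 1; 0; 2; 2; 0]
    ; [:: 0; 0; 1; 0; 0; 0; 2; 3; 1]
    ; [:: 0; 0; 0; 2; 1; 1; 1; 0; 0]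
    ; [:: 0; 0; 0; 0; 1; 1; 3; 2; 0]
    ; [:: 0; 0; 0; 0; 0; 1; 3; 3; 1] ]%N.

(** * Exhaustive search over the supports *)

Ltac solve_coefs :=
  by do ?[apply/andP; split]; (exact/eqP || (apply/eqP; lra)).

(** Each coefficient is split into zero or positive. Counting terms and asking for degree 3
    eliminates most patterns; on each remaining one the equations are either contradictory or have a
    single solution. *)
Lemma four_term_cubics_complete (R : realFieldType)
    (p10 p01 p20 p11 p02 p30 p21 p12 p03 : R) :
  let a := [:: p10; p01; p20; p11; p02; p30; p21; p12; p03] in
  all (fun c => 0 <= c) a -> count (fun c => c != 0) a = 4%N ->
  has (fun c => c != 0) (drop 5 a) ->
  p10 + p20 + p30 = 1 ->
  2 * p10 + p01 + p20 + p11 + p21 = 3 ->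
  p10 + 2 * p01 + p11 + p02 + p12 = 3 ->
  p01 + p02 + p03 = 1 ->
  a \in [seq [seq k%:R | k <- s] | s <- four_term_cubics].
Proof.
move=> a; rewrite {}/a /= !andbT !orbF => a_ge0.
(* Strict inequalities, unlike disequalities, are usable by [lra]. *)
have pos (c : R) : 0 <= c -> c != 0 -> 0 < c by move=> c0; rewrite lt0r c0 andbT.
case/andP: a_ge0 => h1 /andP[h2 /andP[h3 /andP[h4 /andP[h5]]]].
case/andP => h6 /andP[h7 /andP[h8 h9]].
rewrite !inE !eqseq_cons !andbT.
case: (p10 =P 0) => [->|/eqP/(pos _ h1) {h1} h1];
case: (p01 =P 0) => [->|/eqP/(pos _ h2) {h2} h2];
case: (p20 =P 0) => [->|/eqP/(pos _ h3) {h3} h3];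
case: (p11 =P 0) => [->|/eqP/(pos _ h4) {h4} h4];
case: (p02 =P 0) => [->|/eqP/(pos _ h5) {h5} h5];
case: (p30 =P 0) => [->|/eqP/(pos _ h6) {h6} h6];
case: (p21 =P 0) => [->|/eqP/(pos _ h7) {h7} h7];
case: (p12 =P 0) => [->|/eqP/(pos _ h8) {h8} h8];
case: (p03 =P 0) => [->|/eqP/(pos _ h9) {h9} h9];
move=> // _; rewrite /= ?orbF => // _ e1 e2 e3 e4.
(* Twelve of the supports survive [lra]. *)
all: try by exfalso; lra.
(* Walks through the twelve candidates until one has all its coefficients forced by the
   equations. *)
all: by do 11?[apply/orP; (left; solve_coefs) || right]; solve_coefs.
Qed.

(** * The twelve cubics are distinct and admissible *)

Section Counting.
Variable R : realType.

Definition nat_cubic (s : seq nat) : {mpoly R[2]} := cubic [seq k%:R | k <- s].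

Lemma size_four_term_cubics s : s \in four_term_cubics -> size s = 9.
Proof. by move=> s12; apply/eqP; move: s s12; apply/allP. Qed.

Lemma nat_cubic_inj : {in four_term_cubics &, injective nat_cubic}.
Proof.
move=> s t /size_four_term_cubics szs /size_four_term_cubics szt eqst.
(* Characteristic zero: a natural number is recovered from its image in [R]. *)
apply: (inj_map (@mulrIn R 1 (oner_neq0 R))).
have szR u : size u = 9 -> size [seq k%:R : R | k <- u] = 9 by rewrite size_map.
rewrite -[LHS](map_mcoeff_cubic (szR s szs)).
rewrite -[RHS](map_mcoeff_cubic (szR t szt)).
by rewrite -!/(nat_cubic _) eqst.
Qed.

Lemma nat_cubic_H2 s : s \in four_term_cubics ->
  H2 R 3 (nat_cubic s) /\ num_terms (nat_cubic s) = 4%N.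
Proof.
move=> s12; have sz := size_four_term_cubics s12.
have szR : size [seq k%:R : R | k <- s] = 9 by rewrite size_map.
have natr_neq0 :
    preim (fun k => k%:R : R) (fun c => c != 0) =1 (fun k => k != 0%N).
  by move=> k /=; rewrite pnatr_eq0.
split; last first.
  rewrite num_terms_cubic // count_map (eq_count natr_neq0).
  by apply/eqP; move: s s12 {sz szR}; apply/allP.
apply/H2P; split.
- apply/eqP; rewrite msize_cubic // -map_drop has_map (eq_has natr_neq0).
  by move: s s12 {sz szR}; apply/allP.
- move=> m; case: (boolP (m \in cubic_mnms)) => [/(nthP 0%MM) [i i9 <-] | mN].
    by rewrite mcoeff_cubic // (nth_map 0%N) ?sz // ler0n.
  by rewrite mcoeff_cubic_out.
- by rewrite mcoeff_cubic_out // -mnm2_00 (mem_map mnm2_inj).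
- apply/meval_cubic_eq1; move: s12; rewrite {sz szR} !inE.
  by do ![case/predU1P => [->|]] => [|||||||||||/eqP ->]; split => /=; ring.
Qed.

End Counting.

Theorem proposition6p3 (R : realType) :
  [set f | H2 R 3 f /\ num_terms f = 4%N] #= `I_12.
Proof.
pose f j := nat_cubic R (nth [::] four_term_cubics j).
(* The set is the image of the twelve positions in the list, so injectivity of [f] there gives the
   cardinality. *)
have -> : [set f | H2 R 3 f /\ num_terms f = 4%N] = f @` `I_12.
  apply/seteqP; split; last first.
    move=> _ [j j12 <-].
    by apply: nat_cubic_H2; rewrite mem_nth.
  move=> g [/H2P[szg g_ge0 g0 g1] tg].
  have gE : g = cubic [seq g@_m | m <- cubic_mnms].
    by rewrite -cubic_mcoeff ?szg.
  set a := map _ _ in gE; have sza : size a = 9 by rewrite size_map.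
  move: g1; rewrite gE => /meval_cubic_eq1 [e1 e2 e3 e4].
  have a_ge0 : all (fun c => 0 <= c) a by rewrite all_map; apply/allP => m _ /=.
  have ta : count (fun c => c != 0) a = 4%N by rewrite -num_terms_cubic // -gE.
  have deg_a : has (fun c => c != 0) (drop 5 a).
    by rewrite -msize_cubic // -gE szg.
  have := four_term_cubics_complete a_ge0 ta deg_a e1 e2 e3 e4.
  case/mapP => s s12 aE; exists (index s four_term_cubics).
    by rewrite -index_mem in s12.
  by rewrite /f nth_index // /nat_cubic -aE.
apply: inj_card_eq => i j; rewrite !inE => i12 j12 /nat_cubic_inj eqij.
apply/eqP; rewrite -(nth_uniq [::] (s := four_term_cubics)) //.
by apply/eqP/eqij; rewrite mem_nth.
Qed.
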